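(* Let $d\ge 2$ and let $A$ be a bi-Koszul algebra determined by $\varDelta_d$. Then the only possibly non-trivial multiplications on the $A_\infty$-Ext-algebra $E(A)$ are $m_2$, $m_3$, $m_4$, $m_d$ and $m_{d+1}$; that is, for every $A_\infty$-Ext-algebra structure $\{m_n\}_{n\ge1}$ on $E(A)$ one has $m_n=0$ for all $n\notin\{2,3,4,d,d+1\}$.
   Context: Fix a field $\mathbb F$. All graded algebras $A=\mathbb F\oplus A_1\oplus A_2\oplus\cdots$ are locally finite, connected and generated in degree 1; $\mathbb F$ also denotes the trivial graded left module $A/A_{\ge 1}$. Put $E(A)=\bigoplus_{p,j}E^p_j(A)$ with $E^p_j(A)=\underline{\mathrm{Ext}}^p_A(\mathbb F,\mathbb F)_{-j}$, where $\underline{\mathrm{Ext}}$ is the derived functor of $\underline{\mathrm{Hom}}_A(M,N)=\bigoplus_n\mathrm{Hom}_{Gr(A)}(M,N[n])$ (degree-zero graded maps, $N[n]_j=N_{n+j}$); $p$ is the cohomological degree and $j$ the lower grading; $E^p(A)=\bigoplus_j E^p_j(A)$. For $d\ge2$ let $\varDelta_d(3k)=(2dk,2dk)$, $\varDelta_d(3k+1)=(2dk+1,2dk+1)$, $\varDelta_d(3k+2)=(2dk+d,2dk+d+1)$ for $k\ge 0$. $A$ is a bi-Koszul algebra determined by $\varDelta_d$ if the trivial module $\mathbb F$ has a minimal graded free resolution $P$ in which $P_n$ is generated in degrees $\varDelta_d(n)$ (the pair viewed as a set) for all $n\ge0$. An $A_\infty$-algebra is a $\mathbb Z$-graded vector space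 $E$ with linear maps $m_n:E^{\otimes n}\to E$ of degree $2-n$ ($n\ge1$) such that for all $n\ge1$, $\sum(-1)^{i+jt}m_{i+1+j}(1^{\otimes i}\otimes m_t\otimes 1^{\otimes j})=0$, the sum over $n=i+t+j$, $i,j\ge0$, $t\ge1$. All $A_\infty$-algebras are strictly unital ($1\in E$ is a two-sided unit for $m_2$, and $m_n(x_1,\dots,x_n)=0$ for $n\ne2$ if some $x_i=1$). An $A_\infty$-Ext-algebra structure on $E(A)$ is one obtained by the minimality theorem (Kadeishvili) from the differential graded algebra $\mathrm{End}_A(P)$, $P$ a free resolution of ${}_A\mathbb F$: thus $m_1=0$, $m_2$ is the Yoneda product, every $m_n$ preserves the lower grading, and $E(A)$ is quasi-isomorphic to $\mathrm{End}_A(P)$ as an $A_\infty$-algebra. *)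

(* Defs.v *)
From HB Require Import structures.
From mathcomp Require Import all_boot all_order all_algebra.
From mathcomp Require Import boolp.
From Stdlib Require List.

Set Implicit Arguments.
Unset Strict Implicit.
Unset Printing Implicit Defensive.

Import GRing.Theory.
Local Open Scope ring_scope.
Local Open Scope quotient_scope.

(* A direct sum decomposition V = \bigoplus_i V_i, given by the projections
   V -> V_i. *)
Record grading (I : eqType) (V : zmodType) := Grading {
  gproj : I -> {additive V -> V};
  gproj_proj : forall i j v,
    gproj i (gproj j v) = if i == j then gproj j v else 0;
  gproj_sum : forall v, exists2 s : seq I,
    uniq s & v = \sum_(i <- s) gproj i v }.

Definition homog (I : eqType) (V : zmodType) (g : grading I V) (i : I) (v : V)
  : Prop := gproj g i v = v.

Definition subalgebra (F : fieldType) (A : algType F) (S : A -> Prop) : Prop :=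
  [/\ S 1, forall (c : F) a, S a -> S (c *: a),
      forall a b, S a -> S b -> S (a + b) & forall a b, S a -> S b -> S (a * b)].

(* A is graded by the natural numbers, connected, locally finite and generated
   in degree 1. *)
Record graded_algebra (F : fieldType) (A : algType F) := GradedAlgebra {
  ga_grading :> grading nat A;
  ga_scale : forall i (c : F) a,
    gproj ga_grading i (c *: a) = c *: gproj ga_grading i a;
  ga_one : homog ga_grading 0%N 1;
  ga_mul : forall i j a b, homog ga_grading i a -> homog ga_grading j b ->
    homog ga_grading (i + j)%N (a * b);
  ga_connected : forall a, homog ga_grading 0%N a -> exists c : F, a = c%:A;
  ga_locally_finite : forall i, exists s : seq A, forall a,
    homog ga_grading i a ->
    exists c : nat -> F, a = \sum_(k < size s) c k *: s`_k;
  ga_generated : forall S : A -> Prop, subalgebra S ->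
    (forall a, homog ga_grading 1%N a -> S a) -> forall a, S a }.

(* The trivial module A / A_{>=1}: the underlying space is F, and A acts
   through the augmentation A -> A_0 = F. *)
Section TrivialModule.
Variables (F : fieldType) (A : algType F) (gA : graded_algebra A).

Lemma aug_subproof (a : A) : exists c : F, gproj gA 0%N a == c%:A.
Proof.
have [|c Hc] := @ga_connected _ _ gA (gproj gA 0%N a).
  by rewrite /homog gproj_proj eqxx.
by exists c; apply/eqP.
Qed.

Definition aug (a : A) : F := xchoose (aug_subproof a).

Lemma augE a : gproj gA 0%N a = (aug a)%:A.
Proof. exact/eqP/(xchooseP (aug_subproof a)). Qed.

Lemma aug_uniq a c : gproj gA 0%N a = c%:A -> aug a = c.
Proof. by rewrite augE => /(fmorph_inj (in_alg A)). Qed.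

Lemma augD a b : aug (a + b) = aug a + aug b.
Proof. by apply: aug_uniq; rewrite raddfD /= !augE scalerDl. Qed.

Lemma aug1 : aug 1 = 1.
Proof. by apply: aug_uniq; rewrite (ga_one gA) scale1r. Qed.

Lemma gproj_homog0 i j a : homog gA j a -> i != j -> gproj gA i a = 0.
Proof. by move=> <- /negPf ne; rewrite gproj_proj ne. Qed.

Lemma augM a b : aug (a * b) = aug a * aug b.
Proof.
apply: aug_uniq; rewrite -[RHS]/(in_alg A _) rmorphM /= -!augE.
have hp i c : homog gA i (gproj gA i c) by rewrite /homog gproj_proj eqxx.
have key c e : gproj gA 0%N (c * e) = gproj gA 0%N c * gproj gA 0%N e.
  have [s us Ec] := gproj_sum gA c; have [t ut Ee] := gproj_sum gA e.
  rewrite {1}Ec mulr_suml raddf_sum {2}Ec raddf_sum mulr_suml.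
  apply: eq_bigr => i _; rewrite {1}Ee mulr_sumr raddf_sum {2}Ee raddf_sum.
  rewrite mulr_sumr; apply: eq_bigr => j _ /=.
  have hij := ga_mul (hp i c) (hp j e).
  rewrite !gproj_proj; case: (eqVneq 0%N i) hij => [<-|ni] hij.
    case: (eqVneq 0%N j) hij => [<-|nj] hij; first exact: hij.
    by rewrite mulr0 (gproj_homog0 hij).
  rewrite mul0r (gproj_homog0 hij) //.
  by rewrite eq_sym addn_eq0 negb_and eq_sym ni.
exact: key.
Qed.

Definition trivmod (gA : graded_algebra A) : Type := F.
HB.instance Definition _ := GRing.Zmodule.on (trivmod gA).

Definition trivmod_scale (a : A) (x : trivmod gA) : trivmod gA := aug a * x.

Fact trivmod_scalerA a b x :
  trivmod_scale a (trivmod_scale b x) = trivmod_scale (a * b) x.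
Proof. by rewrite /trivmod_scale augM mulrA. Qed.
Fact trivmod_scale1r : left_id 1 trivmod_scale.
Proof. by move=> x; rewrite /trivmod_scale aug1 mul1r. Qed.
Fact trivmod_scalerDr : right_distributive trivmod_scale +%R.
Proof. by move=> a x y; rewrite /trivmod_scale mulrDr. Qed.
Fact trivmod_scalerDl x : {morph trivmod_scale^~ x : a b / a + b}.
Proof. by move=> a b; rewrite /trivmod_scale augD mulrDl. Qed.

HB.instance Definition _ := GRing.Zmodule_isLmodule.Build A (trivmod gA)
  trivmod_scalerA trivmod_scale1r trivmod_scalerDr trivmod_scalerDl.

End TrivialModule.

(* A family (M_n)_{n in Z} of Z-graded left A-modules, encoded by its total
   module M = \bigoplus_n M_n: the component of index (n, j) is the part of
   internal degree j of M_n. *)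
Record bigraded_module (F : fieldType) (A : algType F) (gA : graded_algebra A)
    (M : lmodType A) := BigradedModule {
  bm_grading :> grading (int * int)%type M;
  bm_act : forall i n j (a : A) (x : M),
    homog gA i a -> homog bm_grading (n, j) x ->
    homog bm_grading (n, i%:Z + j) (a *: x) }.

Section TrivialBigrading.
Variables (F : fieldType) (A : algType F) (gA : graded_algebra A).

Definition triv_proj (k : int * int) (x : trivmod gA) : trivmod gA :=
  if k == (0, 0) then x else 0.

Fact triv_proj_additive k : zmod_morphism (triv_proj k).
Proof. by move=> x y; rewrite /triv_proj; case: eqP; rewrite // subr0. Qed.

HB.instance Definition _ k :=
  GRing.isZmodMorphism.Build (trivmod gA) (trivmod gA) (triv_proj k)
    (triv_proj_additive k).

Fact triv_proj_proj i j v :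
  triv_proj i (triv_proj j v) = if i == j then triv_proj j v else 0.
Proof.
rewrite /triv_proj; case: (eqVneq j (0, 0)) => [->//|_].
by case: ifP; case: ifP.
Qed.

Fact triv_proj_sum v : exists2 s : seq (int * int),
  uniq s & v = \sum_(i <- s) triv_proj i v.
Proof. by exists [:: (0, 0)]; rewrite // big_seq1. Qed.

Definition triv_grading : grading (int * int)%type (trivmod gA) :=
  @Grading _ _ (fun k => triv_proj k : {additive _ -> _})
    triv_proj_proj triv_proj_sum.

Fact triv_act i n j (a : A) (x : trivmod gA) :
  homog gA i a -> homog triv_grading (n, j) x ->
  homog triv_grading (n, i%:Z + j) (a *: x).
Proof.
rewrite /homog /= /triv_proj => ha; case: eqP => [[-> ->]|_] hx; last first.
  by rewrite -hx scaler0 if_same.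
case: i ha => [|i] ha //=; suff -> : a *: x = 0 by [].
rewrite /GRing.scale /= /trivmod_scale (_ : aug gA a = 0) ?mul0r //.
by apply: aug_uniq; rewrite scale0r -ha gproj_proj.
Qed.

Definition triv_bigraded : bigraded_module gA (trivmod gA) :=
  BigradedModule triv_act.

End TrivialBigrading.

(* f maps the internal degree i part of M_n to the internal degree i - k.2 part
   of N_(n - k.1): cohomological degree k.1 and lower degree k.2. *)
Definition bihomog_map (F : fieldType) (A : algType F) (gA : graded_algebra A)
    (M N : lmodType A) (bM : bigraded_module gA M) (bN : bigraded_module gA N)
    (k : int * int) (f : M -> N) : Prop :=
  forall n i x, homog bM (n, i) x -> homog bN (n - k.1, i - k.2) (f x).

(* The A-linear maps that are finite sums of bihomogeneous A-linear maps: the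
   graded vector space \bigoplus_(p, j) \prod_n Hom_Gr(M_n, N_(n-p)[-j]). *)
Section GradedHom.
Variables (F : fieldType) (A : algType F) (gA : graded_algebra A).
Variables (M N : lmodType A).
Variables (bM : bigraded_module gA M) (bN : bigraded_module gA N).

Definition ghom_pred (f : M -> N) : Prop :=
  exists (T : finType) (k : T -> int * int) (g : T -> {linear M -> N}),
    (forall t, bihomog_map bM bN (k t) (g t)) /\
    forall x, f x = \sum_t g t x.

Record ghom := GHom { ghom_fun :> M -> N; ghomP : ghom_pred ghom_fun }.

HB.instance Definition _ := gen_eqMixin ghom.
HB.instance Definition _ := gen_choiceMixin ghom.

Lemma ghom_ext (f g : ghom) : (forall x, f x = g x) -> f = g.
Proof.
case: f g => [f hf] [g hg] /= /funext efg.
by case: g / efg in hg *; rewrite (Prop_irrelevance hf hg).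
Qed.

Fact ghom_linear (f : ghom) : linear f.
Proof.
case: f => f [T [k [g [_ Ef]]]] a x y /=; rewrite !Ef scaler_sumr -big_split /=.
by apply: eq_bigr => t _; rewrite linearP.
Qed.

HB.instance Definition _ (f : ghom) :=
  GRing.isLinear.Build A M N *:%R f (ghom_linear f).

Lemma homog0 (I : eqType) (V : zmodType) (g : grading I V) i : homog g i 0.
Proof. exact: raddf0. Qed.

Fact ghom_zero_subproof : ghom_pred (fun=> 0).
Proof.
exists void, (fun=> (0, 0)), (fun=> \0 : {linear M -> N}).
by split=> [[]//|x]; rewrite big_const_idem /= ?add0r.
Qed.
Definition ghom_zero := GHom ghom_zero_subproof.

Fact ghom_add_subproof (f g : ghom) : ghom_pred (f \+ g).
Proof.
case: f g => f [T [k [u [hu Ef]]]] [g [T' [k' [u' [hu' Eg]]]]] /=.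
exists (T + T')%type,
  (fun t => match t with inl s => k s | inr s => k' s end),
  (fun t => match t with inl s => u s | inr s => u' s end).
by split=> [[]//|x]; rewrite big_sumType /= Ef Eg.
Qed.
Definition ghom_add f g := GHom (ghom_add_subproof f g).

(* N is an F-vector space through F -> A. *)
Definition scale_alg (c : F) (f : M -> N) (x : M) : N := c%:A *: f x.

Fact scale_alg_linear (c : F) (f : {linear M -> N}) : linear (scale_alg c f).
Proof.
move=> a x y; rewrite /scale_alg linearP scalerDr !scalerA.
by rewrite mulr_algl mulr_algr.
Qed.

HB.instance Definition _ (c : F) (f : {linear M -> N}) :=
  GRing.isLinear.Build A M N *:%R (scale_alg c f) (scale_alg_linear c f).

Lemma bihomog_mapZ k (f : M -> N) (c : F) :
  bihomog_map bM bN k f -> bihomog_map bM bN k (scale_alg c f).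
Proof.
move=> hf n i x /hf hx; have h : homog gA 0%N c%:A.
  by rewrite /homog ga_scale (ga_one gA).
by have := bm_act h hx; rewrite add0r.
Qed.

Fact ghom_scale_subproof (c : F) (f : ghom) : ghom_pred (scale_alg c f).
Proof.
case: f => f [T [k [u [hu Ef]]]] /=; 
exists T, k, (fun t => scale_alg c (u t) : {linear M -> N}).
split=> [t|x] /=; first exact: bihomog_mapZ.
by rewrite /scale_alg Ef scaler_sumr.
Qed.
Definition ghom_scale c f := GHom (ghom_scale_subproof c f).

Definition ghom_opp f := ghom_scale (-1) f.

Fact ghom_addA : associative ghom_add.
Proof. by move=> f g h; apply: ghom_ext => x /=; rewrite addrA. Qed.
Fact ghom_addC : commutative ghom_add.
Proof. by move=> f g; apply: ghom_ext => x /=; rewrite addrC. Qed.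
Fact ghom_add0 : left_id ghom_zero ghom_add.
Proof. by move=> f; apply: ghom_ext => x /=; rewrite add0r. Qed.
Fact ghom_addN : left_inverse ghom_zero ghom_opp ghom_add.
Proof.
by move=> f; apply: ghom_ext => x /=; rewrite /scale_alg scaleN1r scaleNr scale1r addNr.
Qed.

HB.instance Definition _ :=
  GRing.isZmodule.Build ghom ghom_addA ghom_addC ghom_add0 ghom_addN.

Fact ghom_scaleA a b f :
  ghom_scale a (ghom_scale b f) = ghom_scale (a * b) f.
Proof. by apply: ghom_ext => x /=; rewrite /scale_alg scalerA mulr_algl scalerA. Qed.
Fact ghom_scale1 : left_id 1 ghom_scale.
Proof. by move=> f; apply: ghom_ext => x /=; rewrite /scale_alg !scale1r. Qed.
Fact ghom_scaleDr : right_distributive ghom_scale +%R.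
Proof. by move=> c f g; apply: ghom_ext => x /=; rewrite /scale_alg scalerDr. Qed.
Fact ghom_scaleDl f : {morph ghom_scale^~ f : a b / a + b}.
Proof. by move=> a b; apply: ghom_ext => x /=; rewrite /scale_alg !scalerDl. Qed.

HB.instance Definition _ := GRing.Zmodule_isLmodule.Build F ghom
  ghom_scaleA ghom_scale1 ghom_scaleDr ghom_scaleDl.

End GradedHom.

Section Composition.
Variables (F : fieldType) (A : algType F) (gA : graded_algebra A).
Variables (L M N : lmodType A) (bL : bigraded_module gA L).
Variables (bM : bigraded_module gA M) (bN : bigraded_module gA N).

Fact ghom_comp_subproof (f : ghom bM bN) (g : ghom bL bM) :
  ghom_pred bL bN (f \o g).
Proof.
case: (f) (g) => f0 [T [k [u [hu Ef]]]] [g0 [T' [k' [u' [hu' Eg]]]]] /=.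
exists (T * T')%type, (fun t => k t.1 + k' t.2),
  (fun t => u t.1 \o u' t.2 : {linear L -> N}).
split=> [[t t'] n i x hx|x] /=.
  have e (a b c : int) : a - (b + c) = a - c - b by rewrite opprD addrA addrAC.
  by rewrite !e; exact: hu (hu' _ _ _ _ hx).
rewrite -(pair_bigA _ (fun t t' => u t (u' t' x))) /= Ef Eg.
by apply: eq_bigr => t _; rewrite linear_sum.
Qed.
Definition ghom_comp f g : ghom bL bN := GHom (ghom_comp_subproof f g).

End Composition.

(* ker D / im D for an F-linear map D with D \o D = 0 *)
Section Cohomology.
Variables (F : fieldType) (V : lmodType F) (D : {linear V -> V}).

Definition cocycle_pred : {pred V} := fun v => D v == 0.

Fact cocycle_submod_closed : submod_closed cocycle_pred.
Proof.
split=> [|a u v]; rewrite !unfold_in ?linear0 // linearP => /eqP-> /eqP->.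
by rewrite scaler0 addr0.
Qed.
HB.instance Definition _ :=
  GRing.isSubmodClosed.Build F V cocycle_pred cocycle_submod_closed.

Record cocycle := Cocycle { cocycle_val :> V; _ : cocycle_val \in cocycle_pred }.

HB.instance Definition _ := [isSub for cocycle_val].
HB.instance Definition _ := [Choice of cocycle by <:].
HB.instance Definition _ := [SubChoice_isSubLmodule of cocycle by <:].

Definition coboundary_pred : {pred cocycle} :=
  fun z => `[< exists w, val z = D w >].

Fact coboundary_zmod_closed : zmod_closed coboundary_pred.
Proof.
split=> [|x y]; rewrite !unfold_in.
  by apply/asboolP; exists 0; rewrite linear0 raddf0.
move=> /asboolP[u Eu] /asboolP[v Ev]; apply/asboolP; exists (u - v).
by rewrite [LHS]raddfB [RHS]raddfB /= Eu Ev.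
Qed.
HB.instance Definition _ :=
  GRing.isZmodClosed.Build cocycle coboundary_pred coboundary_zmod_closed.

Definition cohomology : Type := Quotient.quot coboundary_pred.
HB.instance Definition _ := GRing.Zmodule.on cohomology.

Definition cohom_class (z : cocycle) : cohomology :=
  \pi_(Quotient.quot coboundary_pred) z.

Fact cohom_class_additive : zmod_morphism cohom_class.
Proof. by move=> x y; rewrite /cohom_class raddfB. Qed.
HB.instance Definition _ :=
  GRing.isZmodMorphism.Build cocycle cohomology cohom_class
    cohom_class_additive.

Definition cohom_repr (x : cohomology) : cocycle :=
  repr (x : Quotient.quot coboundary_pred).

Lemma cohom_reprK x : cohom_class (cohom_repr x) = x.
Proof. exact: reprK. Qed.

Lemma cohom_class_eq y z :
  cohom_class y = cohom_class z <-> exists w, val y - val z = D w.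
Proof.
have -> : (cohom_class y = cohom_class z) <-> (y - z \in coboundary_pred).
  by rewrite Quotient.idealrBE; split=> [/eqP|/eqP].
by rewrite unfold_in; split=> [/asboolP|h]; last apply/asboolP; rewrite ?raddfB.
Qed.

Definition cohom_scale (c : F) (x : cohomology) : cohomology :=
  cohom_class (c *: cohom_repr x).

Lemma cohom_scaleE c z : cohom_scale c (cohom_class z) = cohom_class (c *: z).
Proof.
apply/cohom_class_eq; have /cohom_class_eq[w Ew] := cohom_reprK (cohom_class z).
by exists (c *: w); rewrite [RHS]linearZ /= -Ew scalerBr.
Qed.

Fact cohom_scalerA a b x :
  cohom_scale a (cohom_scale b x) = cohom_scale (a * b) x.
Proof. by rewrite -[x]cohom_reprK !cohom_scaleE scalerA. Qed.
Fact cohom_scale1r : left_id 1 cohom_scale.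
Proof. by move=> x; rewrite -[x]cohom_reprK cohom_scaleE scale1r. Qed.
Fact cohom_scalerDr : right_distributive cohom_scale +%R.
Proof.
move=> a x y; rewrite -[x]cohom_reprK -[y]cohom_reprK.
move: (cohom_repr x) (cohom_repr y) => u v.
by rewrite -raddfD !cohom_scaleE scalerDr raddfD.
Qed.
Fact cohom_scalerDl x : {morph cohom_scale^~ x : a b / a + b}.
Proof.
by move=> a b; rewrite -[x]cohom_reprK !cohom_scaleE scalerDl raddfD.
Qed.
HB.instance Definition _ := GRing.Zmodule_isLmodule.Build F cohomology
  cohom_scalerA cohom_scale1r cohom_scalerDr cohom_scalerDl.

Definition represents (v : V) (x : cohomology) : Prop :=
  exists2 z : cocycle, val z = v & cohom_class z = x.

End Cohomology.

Section FreeResolution.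
Variables (F : fieldType) (A : algType F) (gA : graded_algebra A).
Variables (P : lmodType A) (bP : bigraded_module gA P).

(* P has an A-basis of bihomogeneous elements, i.e. every P_n is graded free. *)
Definition graded_free : Prop :=
  exists B : P -> Prop,
  [/\ forall b, B b -> exists k, homog bP k b,
      forall x, exists (T : finType) (a : T -> A) (b : T -> P),
        (forall t, B (b t)) /\ x = \sum_t a t *: b t
    & forall s : seq P, uniq s -> (forall b, b \in s -> B b) ->
      forall a : P -> A, \sum_(b <- s) a b *: b = 0 ->
      forall b, b \in s -> a b = 0].

(* A graded free resolution ... -> P_1 -> P_0 -> F -> 0 of the trivial module.
   The differential P_n -> P_(n-1) has cohomological degree 1 and lower degree
   0. Exactness of the total complex is exactness at every P_n, since res_aug
   vanishes on P_n for n != 0. *)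
Record free_resolution := FreeResolution {
  res_d : ghom bP bP;
  res_aug : ghom bP (triv_bigraded gA);
  res_d_deg : bihomog_map bP bP (1, 0) res_d;
  res_aug_deg : bihomog_map bP (triv_bigraded gA) (0, 0) res_aug;
  res_nonneg : forall n j x, homog bP (n, j) x -> n < 0 -> x = 0;
  res_free : graded_free;
  res_dd : forall x, res_d (res_d x) = 0;
  res_augd : forall x, res_aug (res_d x) = 0;
  res_exact : forall x, res_d x = 0 -> res_aug x = 0 ->
    exists y, x = res_d y;
  res_aug_surj : forall c, exists x, res_aug x = c }.

(* The differential takes values in A_{>=1} P. *)
Definition minimal (R : free_resolution) : Prop :=
  forall x, exists (T : finType) (a : T -> A) (y : T -> P),
    (forall t, gproj gA 0%N (a t) = 0) /\ res_d R x = \sum_t a t *: y t.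

(* The A-module P_n is generated by its elements of degrees in S. *)
Definition generated_in_degrees (n : nat) (S : seq nat) : Prop :=
  forall j x, homog bP (n%:Z, j) x ->
  exists (T : finType) (a : T -> A) (y : T -> P),
    (forall t, exists2 e : nat, e \in S & homog bP (n%:Z, e%:Z) (y t)) /\
    x = \sum_t a t *: y t.

End FreeResolution.

Definition Delta (d n : nat) : nat * nat :=
  let k := (n %/ 3)%N in
  match (n %% 3)%N with
  | 0 => (2 * d * k, 2 * d * k)%N
  | 1 => (2 * d * k + 1, 2 * d * k + 1)%N
  | _ => (2 * d * k + d, 2 * d * k + d + 1)%N
  end.

Definition bi_Koszul (F : fieldType) (A : algType F) (gA : graded_algebra A)
    (d : nat) : Prop :=
  exists (P : lmodType A) (bP : bigraded_module gA P) (R : free_resolution bP),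
    minimal R /\ forall n,
      generated_in_degrees bP n [:: (Delta d n).1; (Delta d n).2].

(* Given V = \bigoplus_(p, j) V^p_j: membership in V^p = \bigoplus_j V^p_j *)
Definition in_degree (V : zmodType) (h : int * int -> V -> Prop) (p : int)
    (v : V) : Prop :=
  exists (T : finType) (j : T -> int) (w : T -> V),
    (forall t, h (p, j t) (w t)) /\ v = \sum_t w t.

(* A family of multilinear maps m_n : V^n -> V, n >= 1, is encoded by one
   function m : seq V -> V; m_n is its restriction to the sequences of length n,
   and m [::] is irrelevant. Tensor products of maps are evaluated with the
   Koszul sign (f (x) g)(u (x) v) = (-1)^(|g| |u|) f(u) (x) g(v). *)
Section AinfAlgebra.
Variables (F : fieldType) (V W : lmodType F).
Variables (degV : int -> V -> Prop) (degW : int -> W -> Prop).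

Definition multilinear (f : seq V -> W) : Prop :=
  forall s1 s2, linear (fun x => f (s1 ++ x :: s2)).

(* f_n has degree r - n. *)
Definition multi_degree (r : int) (f : seq V -> W) : Prop :=
  forall (ps : seq int) (xs : seq V), List.Forall2 degV ps xs ->
  (0 < size xs)%N -> degW (\sum_(p <- ps) p + r - (size xs)%:Z) (f xs).

(* \sum (-1)^(i + j t) f_(i+1+j) (1^(x)i (x) m_t (x) 1^(x)j), the sum over
   n = i + t + j with t >= 1, evaluated at x_1, ..., x_n of degrees
   p_1, ..., p_n. The last sign is the Koszul sign; m_t has degree 2 - t. *)
Definition stasheff_sum (m : seq V -> V) (f : seq V -> W)
    (ps : seq int) (xs : seq V) : W :=
  let n := size xs in
  \sum_(i < n) \sum_(1 <= t < (n - i).+1)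
    let j := (n - i - t)%N in
    ((-1) ^+ (i + j * t) * (-1) ^ ((2 - t%:Z) * \sum_(p <- take i ps) p)) *:
      f (take i xs ++ m (take t (drop i xs)) :: drop (i + t) xs).

End AinfAlgebra.

Section AinfMorphism.
Variables (F : fieldType) (V : lmodType F) (degV : int -> V -> Prop).

Record Ainf_algebra (m : seq V -> V) : Prop := AinfAlgebra {
  Ainf_multilinear : multilinear m;
  Ainf_degree : multi_degree degV degV 2 m;
  Ainf_stasheff : forall ps xs, List.Forall2 degV ps xs ->
    (0 < size xs)%N -> stasheff_sum m m ps xs = 0 }.

Definition strictly_unital (m : seq V -> V) (e : V) : Prop :=
  [/\ forall x, m [:: e; x] = x, forall x, m [:: x; e] = x
    & forall xs, (0 < size xs)%N -> size xs != 2 -> e \in xs -> m xs = 0].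

(* A differential graded algebra C, with differentials d^p : C^p -> C^(p+1) and
   product *, viewed as an A_infinity-algebra with m_1 = d, m_2 = *, and m_n = 0
   for n >= 3. *)
Variables (C : lmodType F) (degC : int -> C -> Prop).
Variables (dC : int -> C -> C) (mulC : C -> C -> C).

(* f_n : V^(x)n -> C of degree 1 - n with
     \sum (-1)^(i + j t) f_(i+1+j) (1^(x)i (x) m_t (x) 1^(x)j)
       = m_1 f_n + \sum_(a + b = n) (-1)^(a-1) m_2 (f_a (x) f_b). *)
Record Ainf_morphism_to_dga (m : seq V -> V) (f : seq V -> C) : Prop :=
  AinfMorphismToDga {
  Ainf_mor_multilinear : multilinear f;
  Ainf_mor_degree : multi_degree degV degC 1 f;
  Ainf_mor_eq : forall ps xs, List.Forall2 degV ps xs ->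
    (0 < size xs)%N ->
    let n := size xs in
    stasheff_sum m f ps xs =
      dC (\sum_(p <- ps) p + 1 - n%:Z) (f xs) +
      \sum_(1 <= a < n)
        ((-1) ^+ a.-1 *
         (-1) ^ ((1 - (n - a)%N%:Z) * \sum_(p <- take a ps) p)) *:
          mulC (f (take a xs)) (f (drop a xs)) }.

(* f_1 induces isomorphisms H^p(V, m_1) -> H^p(C, d). *)
Definition quasi_isomorphism (m : seq V -> V) (f : seq V -> C) : Prop :=
  forall p,
  (forall x, degV p x -> m [:: x] = 0 ->
     (exists2 w, degC (p - 1) w & f [:: x] = dC (p - 1) w) ->
     exists2 y, degV (p - 1) y & x = m [:: y]) /\
  (forall z, degC p z -> dC p z = 0 ->
     exists x w, [/\ degV p x, m [:: x] = 0, degC (p - 1) w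
       & z = f [:: x] + dC (p - 1) w]).

End AinfMorphism.

Section ExtAlgebra.
Variables (F : fieldType) (A : algType F) (gA : graded_algebra A).
Variables (P : lmodType A) (bP : bigraded_module gA P).
Variable (R : free_resolution bP).

Local Notation homPF := (ghom bP (triv_bigraded gA)).
Local Notation endP := (ghom bP bP).

Definition Hom_d (f : homPF) : homPF := ghom_comp f (res_d R).

Fact Hom_d_linear : linear Hom_d.
Proof. by move=> c f g; apply: ghom_ext. Qed.
HB.instance Definition _ :=
  GRing.isLinear.Build F homPF homPF *:%R Hom_d Hom_d_linear.

(* E(A) = Ext_A(F, F), the cohomology of Hom_A(P, F) *)
Definition Ext : lmodType F := cohomology Hom_d.

(* E^p_j(A), for k = (p, j) *)
Definition Ext_comp (k : int * int) (x : Ext) : Prop :=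
  exists2 f : homPF, bihomog_map bP (triv_bigraded gA) k f & represents f x.

(* The differential graded algebra End_A(P): End^p_j, the differential of End^p,
   and composition *)
Definition End_comp (k : int * int) (f : endP) : Prop := bihomog_map bP bP k f.

Definition End_d (p : int) (f : endP) : endP :=
  ghom_comp (res_d R) f - (-1) ^ p *: ghom_comp f (res_d R).

(* x y is the class of f \o g, where the cocycle f : P -> F represents x and the
   chain map g : P -> P (up to sign) lifts a representative of y. *)
Definition yoneda_product (m : seq Ext -> Ext) : Prop :=
  forall p (x y : Ext) (f : homPF) (g : endP),
  in_degree End_comp p g -> End_d p g = 0 ->
  represents f x -> represents (ghom_comp (res_aug R) g) y ->
  represents (ghom_comp f g) (m [:: x; y]).

Record Ainf_Ext_structure (m : seq Ext -> Ext) : Prop := AinfExtStructure {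
  Ext_Ainf : Ainf_algebra (in_degree Ext_comp) m;
  Ext_unital : exists2 e, represents (res_aug R) e & strictly_unital m e;
  Ext_m1 : forall x, m [:: x] = 0;
  Ext_m2 : yoneda_product m;
  Ext_lower : forall (ks : seq (int * int)) (xs : seq Ext),
    List.Forall2 Ext_comp ks xs -> (0 < size xs)%N ->
    Ext_comp (\sum_(k <- ks) k.1 + 2 - (size xs)%:Z, \sum_(k <- ks) k.2) (m xs);
  Ext_quasi_iso : exists f : seq Ext -> endP,
    Ainf_morphism_to_dga (in_degree Ext_comp) (in_degree End_comp)
      End_d (fun g h => ghom_comp g h) m f /\
    quasi_isomorphism (in_degree Ext_comp) (in_degree End_comp) End_d m f }.

End ExtAlgebra.

(* Main.v *)
(* Comparing R with the resolution generated in the degrees of Delta, a cocycle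
   of bidegree (p, j) with j outside Delta(p) is a coboundary: composed with the
   comparison maps it kills the generators, and the homotopy gives a primitive.
   Hence E^p_j = 0 unless j lies in Delta(p). As m_n maps bidegrees k_1, ..., k_n
   to (2 - n, 0) + k_1 + ... + k_n, a non-zero value of m_n on homogeneous
   elements forces a numerical identity that holds only for the listed n. *)

From HB Require Import structures.
Require Import Defs.
From mathcomp Require Import all_boot all_order all_algebra.
From mathcomp Require Import boolp zify.
From Stdlib Require List.

Set Implicit Arguments.
Unset Strict Implicit.
Unset Printing Implicit Defensive.

Import Order.TTheory GRing.Theory.

(** * Homogeneous components of graded groups *)

Section GradingTheory.
Local Open Scope ring_scope.
Variables (I : eqType) (V : zmodType) (g : grading I V).

Lemma gproj_homog i v : homog g i (gproj g i v).
Proof. by rewrite /homog gproj_proj eqxx. Qed.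

Lemma gproj_neq0 i j v : homog g j v -> i != j -> gproj g i v = 0.
Proof. by move=> <- /negPf ne; rewrite gproj_proj ne. Qed.

Lemma homogD i u v : homog g i u -> homog g i v -> homog g i (u + v).
Proof. by rewrite /homog raddfD => -> ->. Qed.

Lemma homog_eq (W : zmodType) (f h : {additive V -> W}) :
  (forall i v, homog g i v -> f v = h v) -> f =1 h.
Proof.
move=> E v; have [s _ ->] := gproj_sum g v; rewrite !raddf_sum.
by apply: eq_bigr => i _; apply: (E i); apply: gproj_homog.
Qed.

End GradingTheory.

(** * Bihomogeneous maps and projections *)

Section Bihomogeneous.
Local Open Scope ring_scope.
Variables (F : fieldType) (A : algType F) (gA : graded_algebra A).
Variables (M N : lmodType A).
Variables (bM : bigraded_module gA M) (bN : bigraded_module gA N).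

Lemma bihomog_gproj c (f : {linear M -> N}) n i x : bihomog_map bM bN c f ->
  f (gproj bM (n, i) x) = gproj bN (n - c.1, i - c.2) (f x).
Proof.
move=> hf.
apply: (homog_eq (g := bM) (f := f \o gproj bM (n, i))
  (h := gproj bN (n - c.1, i - c.2) \o f)) => -[m j] v hv /=.
case: (eqVneq (n, i) (m, j)) => [[-> ->]|ne].
  by rewrite hv; apply/esym; apply: hf.
rewrite (gproj_neq0 hv ne) raddf0; apply/esym/(gproj_neq0 (hf _ _ _ hv)).
apply: contra ne => /eqP[/addIr -> /addIr ->]; exact: eqxx.
Qed.

Lemma bihomog_ghom_pred c (f : {linear M -> N}) :
  bihomog_map bM bN c f -> ghom_pred bM bN f.
Proof.
move=> hf; exists 'I_1, (fun=> c), (fun=> f); split=> // x.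
by rewrite big_ord1.
Qed.

End Bihomogeneous.

(** * Graded free modules: induction on, and extension from, a homogeneous basis *)

Section FreeModules.
Local Open Scope ring_scope.
Variables (F : fieldType) (A : algType F) (gA : graded_algebra A).
Variables (P : lmodType A) (bP : bigraded_module gA P).

(** The condition under the quantifier of [graded_free], so that a witness of freeness has this type
    by conversion. *)
Definition graded_basis (B : P -> Prop) : Prop :=
  [/\ forall b, B b -> exists k, homog bP k b,
      forall x, exists (T : finType) (a : T -> A) (b : T -> P),
        (forall t, B (b t)) /\ x = \sum_t a t *: b t
    & forall s : seq P, uniq s -> (forall b, b \in s -> B b) ->
      forall a : P -> A, \sum_(b <- s) a b *: b = 0 ->
      forall b, b \in s -> a b = 0].

Variables (B : P -> Prop) (hB : graded_basis B).

(** Projecting a basis expansion of [x] to bidegree [(n, i)] keeps only the terms whose coefficient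
    component and basis element have degrees adding up to it. *)
Lemma homog_basis_ind n i (Q : P -> Prop) :
  Q 0 -> (forall x y, Q x -> Q y -> Q (x + y)) ->
  (forall l e a b, homog gA l a -> B b -> homog bP (n, e) b -> l%:Z + e = i ->
     Q (a *: b)) ->
  forall x, homog bP (n, i) x -> Q x.
Proof.
move=> Q0 QD Qb x hx; have [hBk hBx _] := hB.
have [T [a [b [Bb Ex]]]] := hBx x.
rewrite -hx {}Ex raddf_sum; apply: big_ind => // t _.
have [s _ Ea] := gproj_sum gA (a t).
rewrite {}Ea scaler_suml raddf_sum; apply: big_ind => // l _.
have [[m e] hb] := hBk _ (Bb t).
have ha := gproj_homog gA l (a t); have hab := bm_act ha hb.
case: (eqVneq (n, i) (m, l%:Z + e)) => [[Em Ei]|ne].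
  by rewrite Em Ei hab; apply: (Qb l e); rewrite ?Em.
by rewrite (gproj_neq0 hab ne).
Qed.

(** Expansions may repeat basis elements, while independence concerns duplicate-free lists;
    collecting the coefficients of equal elements passes from one to the other. *)
Lemma sum_regroup (N : lmodType A) (T : finType) (a : T -> A) (b : T -> P) (g : P -> N) :
  \sum_t a t *: g (b t) =
  \sum_(y <- undup (codom b)) (\sum_(t | b t == y) a t) *: g y.
Proof.
under [RHS]eq_bigr => y _ do rewrite scaler_suml.
rewrite (exchange_big_dep xpredT) //=; apply: eq_bigr => t _.
have bt : b t \in undup (codom b) by rewrite mem_undup codom_f.
rewrite -big_filter; have -> : [seq y <- undup (codom b) | b t == y] = [:: b t].
  under eq_filter => y do rewrite eq_sym.
  by rewrite filter_pred1_uniq ?undup_uniq.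
by rewrite big_seq1.
Qed.

Variables (N : lmodType A).

Lemma basis_relation (T : finType) (a : T -> A) (b : T -> P) (g : P -> N) :
  (forall t, B (b t)) -> \sum_t a t *: b t = 0 -> \sum_t a t *: g (b t) = 0.
Proof.
move=> Bb; rewrite (sum_regroup a b id) (sum_regroup a b g) => E0.
have [_ _ indep] := hB; rewrite big_seq big1 // => y ys.
rewrite (indep _ (undup_uniq _) _ _ E0 y ys) ?scale0r // => z.
by rewrite mem_undup => /codomP[t ->].
Qed.

(** The graph of [L] is [rel]: spanning makes it total, independence makes it single-valued, and
    closure under linear combinations makes [L] linear. *)
Lemma basis_extension (g : P -> N) :
  exists L : {linear P -> N}, forall b, B b -> L b = g b.
Proof.
pose rel x y := exists (T : finType) (a : T -> A) (b : T -> P),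
  [/\ forall t, B (b t), x = \sum_t a t *: b t & y = \sum_t a t *: g (b t)].
have [_ hBx _] := hB.
have relP c x y x' y' : rel x y -> rel x' y' -> rel (c *: x + x') (c *: y + y').
  move=> [T [a [b [Bb -> ->]]]] [T' [a' [b' [Bb' -> ->]]]].
  exists (T + T')%type,
    (fun t => match t with inl s => c * a s | inr s => a' s end),
    (fun t => match t with inl s => b s | inr s => b' s end).
  split=> [[]//||]; rewrite big_sumType /= scaler_sumr; congr (_ + _);
    by apply: eq_bigr => t _; rewrite scalerA.
have rel0 y : rel 0 y -> y = 0.
  by move=> [T [a [b [Bb /esym E0 ->]]]]; apply: basis_relation.
have reluniq x y y' : rel x y -> rel x y' -> y = y'.
  move=> h h'; have := relP (-1) _ _ _ _ h h'.
  by rewrite !scaleN1r addNr => /rel0/eqP; rewrite addrC subr_eq0 => /eqP.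
have /choice[L relL] : forall x, exists y, rel x y.
  move=> x; have [T [a [b [Bb Ex]]]] := hBx x.
  by exists (\sum_t a t *: g (b t)), T, a, b.
have L_lin : linear L.
  by move=> c x y; apply: reluniq (relL _) _; apply: relP.
exists (HB.pack_for {linear P -> N} L
  (GRing.isLinear.Build A P N *:%R L L_lin)) => b Bb /=.
apply: reluniq (relL _) _; exists 'I_1, (fun=> 1), (fun=> b).
by split=> //; rewrite big_ord1 scale1r.
Qed.

End FreeModules.

(** * Lifting a map along a differential in one homological degree *)

Section Lifting.
Local Open Scope ring_scope.
Variables (F : fieldType) (A : algType F) (gA : graded_algebra A).
Variables (P Q M : lmodType A) (bP : bigraded_module gA P).
Variables (bQ : bigraded_module gA Q) (bM : bigraded_module gA M).

(** The inductive step shared by comparison maps and homotopies: [h] is redefined only on basis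
    elements of homological degree [n], by chosen preimages under [delta]. *)
Lemma lift_step (c e : int * int) (delta : {linear Q -> M})
    (g : {linear P -> M}) (h : {linear P -> Q}) (n : int) :
  graded_free bP -> bihomog_map bQ bM e delta -> bihomog_map bP bM (c + e) g ->
  bihomog_map bP bQ c h ->
  (forall i x, homog bP (n, i) x -> exists y, g x = delta y) ->
  exists h' : {linear P -> Q}, [/\ bihomog_map bP bQ c h',
    forall m i x, m != n -> homog bP (m, i) x -> h' x = h x
    & forall i x, homog bP (n, i) x -> delta (h' x) = g x].
Proof.
move=> [B hB] hd hg hh lift; have [hBk _ _] := (hB : graded_basis bP B).
have /choice[h0 h0P] : forall b, exists y, B b -> forall m i,
    homog bP (m, i) b -> [/\ homog bQ (m - c.1, i - c.2) y,
      m = n -> delta y = g b & m != n -> y = h b].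
  (* Zero is homogeneous in every bidegree; only a nonzero [b] has a unique one. *)
  move=> b; have [->|b0] := eqVneq b 0.
    by exists 0 => _ m i _; split; rewrite ?linear0 //; apply: homog0.
  have [Bb|nB] := pselect (B b); last by exists 0.
  have [[m i] hb] := hBk b Bb.
  have uni m' i' : homog bP (m', i') b -> (m', i') = (m, i).
    by move=> hb'; apply: contraNeq b0 => ne; rewrite -hb' (gproj_neq0 hb ne).
  have [Em|nm] := eqVneq m n; last first.
    exists (h b) => _ m' i' /uni[-> ->]; split=> //; first exact: hh.
    by move/eqP: nm.
  have [|y gy] := lift i b; first by rewrite -Em.
  (* The preimage [y] may be inhomogeneous; its component in the right bidegree still maps to [g b],
     as [delta] commutes with projections and [g b] is homogeneous. *)
  exists (gproj bQ (m - c.1, i - c.2) y) => _ m' i' /uni[-> ->].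
  rewrite Em eqxx; split=> // [|_]; first exact: gproj_homog.
  rewrite (bihomog_gproj _ _ _ hd) -gy.
  have := hg _ _ _ hb; rewrite /homog /= Em => hgb; rewrite -[RHS]hgb.
  by rewrite !opprD !addrA.
have [h' h'E] := basis_extension hB h0.
have h'B b m i : B b -> homog bP (m, i) b -> [/\ homog bQ (m - c.1, i - c.2) (h' b),
      m = n -> delta (h' b) = g b & m != n -> h' b = h b].
  by move=> Bb /(h0P b Bb); rewrite h'E.
exists h'; split.
- move=> m i; apply: (homog_basis_ind hB
    (Q := fun x => homog bQ (m - c.1, i - c.2) (h' x))) => [|x y hx hy|l k a b ha Bb hb <-].
  + by rewrite linear0; apply: homog0.
  + by rewrite linearD; apply: homogD.
  have [hb' _ _] := h'B _ _ _ Bb hb.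
  by rewrite linearZ -addrA; apply: bm_act.
- move=> m i x nm;
  apply: (homog_basis_ind hB (Q := fun x => h' x = h x)) => [|y z|l k a b _ Bb hb _].
  + by rewrite !linear0.
  + by rewrite !linearD => -> ->.
  by have [_ _ E] := h'B _ _ _ Bb hb; rewrite !linearZ E.
- move=> i;
  apply: (homog_basis_ind hB (Q := fun x => delta (h' x) = g x)) => [|y z|l k a b _ Bb hb _].
  + by rewrite !linear0.
  + by rewrite !linearD => -> ->.
  by have [_ E _] := h'B _ _ _ Bb hb; rewrite !linearZ /= E.
Qed.

End Lifting.

(** * Comparison maps and homotopies between resolutions *)

Section Resolutions.
Local Open Scope ring_scope.
Variables (F : fieldType) (A : algType F) (gA : graded_algebra A).

Lemma triv_bihomog_eq0 (P : lmodType A) (bP : bigraded_module gA P) k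
    (f : P -> trivmod gA) n i x :
  bihomog_map bP (triv_bigraded gA) k f -> homog bP (n, i) x ->
  (n, i) != k -> f x = 0.
Proof.
move=> hf hx; case: k hf => p j hf ne; rewrite -[LHS](hf _ _ _ hx) /= /triv_proj.
by case: eqP => // -[/subr0_eq en /subr0_eq ei]; rewrite en ei eqxx in ne.
Qed.

Lemma res_d_homog (P : lmodType A) (bP : bigraded_module gA P)
    (R : free_resolution bP) n i x :
  homog bP (n, i) x -> homog bP (n - 1, i) (res_d R x).
Proof. by move/(res_d_deg R); rewrite /= subr0. Qed.

Variables (P Q : lmodType A).
Variables (bP : bigraded_module gA P) (bQ : bigraded_module gA Q).
Variables (R : free_resolution bP) (S : free_resolution bQ).

(** Commutation up to degree [n] is enough for a class of fixed cohomological degree and avoids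
    gluing infinitely many lifts. In degree [n.+1], the element [phi (res_d R x)] is a cycle by
    induction, so exactness provides its lift. *)
Lemma comparison_map (n : nat) : exists phi : {linear P -> Q},
  [/\ bihomog_map bP bQ (0, 0) phi, forall x, res_aug S (phi x) = res_aug R x
    & forall m i x, m <= n%:Z -> homog bP (m, i) x ->
        res_d S (phi x) = phi (res_d R x)].
Proof.
elim: n => [|n [phi [phi_deg phi_aug phi_d]]].
  have [||i x _|phi [phi_deg _ phiE]] := @lift_step _ _ gA P Q (trivmod gA) bP bQ
    (triv_bigraded gA) (0, 0) (0, 0) (res_aug S) (res_aug R) \0 0 (res_free R)
    (@res_aug_deg _ _ _ _ _ S).
  + exact: (@res_aug_deg _ _ _ _ _ R).
  + by move=> m i x _; apply: homog0.
  + by have [y Ey] := res_aug_surj S (res_aug R x); exists y; apply: esym.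
  exists phi; split=> // [|m i x m0 hx].
    apply: (homog_eq (g := bP) (f := res_aug S \o phi) (h := res_aug R)).
    move=> -[m i] x hx /=; have [m0|m0] := eqVneq m 0.
      by apply: (phiE i); rewrite -m0.
    rewrite (triv_bihomog_eq0 (@res_aug_deg _ _ _ _ _ R) hx); last first.
      by apply: contra m0 => /eqP[->].
    have := phi_deg _ _ _ hx; rewrite /= !subr0 => hpx.
    rewrite (triv_bihomog_eq0 (@res_aug_deg _ _ _ _ _ S) hpx) //.
    by apply: contra m0 => /eqP[->].
  (* For [m <= 0] both differentials land in negative degrees, where the resolutions vanish. *)
  have -> : res_d R x = 0 by apply: (res_nonneg R (res_d_homog R hx)); lia.
  rewrite linear0; apply: (res_nonneg S (res_d_homog S (phi_deg _ _ _ hx))) => /=; lia.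
have [|i x hx|phi' [phi'_deg phi'E phi'_d]] := @lift_step _ _ gA P Q Q bP bQ bQ
    (0, 0) (1, 0) (res_d S) (phi \o res_d R) phi n.+1%:Z (res_free R)
    (@res_d_deg _ _ _ _ _ S) _ phi_deg.
- move=> m i x /(res_d_deg R)/phi_deg /=.
  by rewrite !subr0 add0r.
- have hdx := res_d_homog R hx.
  have [||y Ey] := @res_exact _ _ _ _ _ S (phi (res_d R x)); last by exists y.
    by rewrite (phi_d _ _ _ _ hdx) ?res_dd ?linear0 //; lia.
  by rewrite phi_aug res_augd.
exists phi'; split=> // [|m i x mn hx].
  apply: (homog_eq (g := bP) (f := res_aug S \o phi') (h := res_aug R)).
  move=> -[m i] x hx /=; have [m0|m0] := eqVneq m n.+1%:Z; last first.
    by rewrite (phi'E _ _ _ m0 hx) phi_aug.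
  rewrite (triv_bihomog_eq0 (@res_aug_deg _ _ _ _ _ R) hx) ?m0 //.
  have := phi'_deg _ _ _ hx; rewrite /= !subr0 m0 => hpx.
  by rewrite (triv_bihomog_eq0 (@res_aug_deg _ _ _ _ _ S) hpx).
have hdx := res_d_homog R hx.
rewrite [RHS](phi'E _ _ _ _ hdx); last lia.
have [m0|m0] := eqVneq m n.+1%:Z; first by rewrite m0 in hx; apply: (phi'_d _ _ hx).
by rewrite (phi'E _ _ _ m0 hx); apply: (phi_d _ _ _ _ hx); lia.
Qed.

Lemma nullhomotopy (u : {linear P -> P}) (N : nat) :
  bihomog_map bP bP (0, 0) u -> (forall x, res_aug R (u x) = 0) ->
  (forall m i x, m <= N%:Z -> homog bP (m, i) x ->
     res_d R (u x) = u (res_d R x)) ->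
  exists h : {linear P -> P}, bihomog_map bP bP (-1, 0) h /\
    forall m i x, m <= N%:Z -> homog bP (m, i) x ->
      u x = res_d R (h x) + h (res_d R x).
Proof.
move=> u_deg u_aug u_d.
(* The strict bound [m < n] lets the induction start in negative degrees, where [P] is zero;
   [n = N.+1] is the claim. *)
have H (n : nat) : (n <= N.+1)%N -> exists h : {linear P -> P},
    bihomog_map bP bP (-1, 0) h /\
    forall m i x, m < n%:Z -> homog bP (m, i) x ->
      u x = res_d R (h x) + h (res_d R x).
  elim: n => [_|n IHn nN].
    exists \0; split=> [m i x _|m i x m0 hx]; first exact: homog0.
    by rewrite (res_nonneg R hx m0) !linear0 addr0.
  have [h [h_deg hE]] := IHn (ltnW nN).
  have [|i x hx|h' [h'_deg h'E h'_d]] := @lift_step _ _ gA P P P bP bP bP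
      (-1, 0) (1, 0) (res_d R) (u \- (h \o res_d R)) h n%:Z (res_free R)
      (@res_d_deg _ _ _ _ _ R) _ h_deg.
  - move=> m i x hx; have := u_deg _ _ _ hx => hux.
    have := h_deg _ _ _ (res_d_homog R hx).
    rewrite /= opprK subrK !subr0 in hux * => hhx.
    by rewrite /homog raddfB hhx hux.
  - have hdx := res_d_homog R hx.
    (* This is a cycle: the homotopy identity one degree lower, applied to [res_d R x], gives
       [u d x - d h d x = h d d x = 0]. *)
    have [||y Ey] := @res_exact _ _ _ _ _ R (u x - h (res_d R x)); last by exists y.
      rewrite linearB /= (u_d _ _ _ _ hx); last lia.
      rewrite (hE _ _ _ _ hdx); last lia.
      by rewrite res_dd linear0 addr0 subrr.
    rewrite linearB /= u_aug sub0r.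
    (* If [n = 0] then [res_d R x = 0]; otherwise [h (res_d R x)] has degree [n], where the
       augmentation vanishes. *)
    have [n0|n0] := posnP n.
      rewrite (res_nonneg R hdx); last lia.
      by rewrite !linear0.
    have := h_deg _ _ _ hdx; rewrite /= opprK subrK => hhx.
    rewrite (triv_bihomog_eq0 (@res_aug_deg _ _ _ _ _ R) hhx) ?oppr0 //.
    by apply/eqP => -[]; lia.
  exists h'; split=> // m i x mn hx; have hdx := res_d_homog R hx.
  rewrite (h'E _ _ _ _ hdx); last lia.
  have [m0|m0] := eqVneq m n%:Z; last first.
    by rewrite (h'E _ _ _ m0 hx) (hE _ _ _ _ hx) //; lia.
  by rewrite m0 in hx; rewrite (h'_d _ _ hx) /= subrK.
have [h [h_deg hE]] := H _ (leqnn _); by exists h.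
Qed.

End Resolutions.

(** * Vanishing and decomposition of the components of Ext *)

Section ExtComponents.
Local Open Scope ring_scope.
Variables (F : fieldType) (A : algType F) (gA : graded_algebra A).
Variables (P : lmodType A) (bP : bigraded_module gA P) (R : free_resolution bP).

Lemma represents_coboundary (f w : ghom bP (triv_bigraded gA)) (x : Ext R) :
  represents f x -> f = Hom_d R w -> x = 0.
Proof.
move=> [z zf <-] fw; rewrite -[RHS](raddf0 (@cohom_class _ _ (Hom_d R))).
by apply/cohom_class_eq; exists w; rewrite zf -[X in f - X]/(0 : ghom bP (triv_bigraded gA)) subr0.
Qed.

Lemma represents_cocycle (f : ghom bP (triv_bigraded gA)) (x : Ext R) y :
  represents f x -> f (res_d R y) = 0.
Proof. by move=> [[z zP] /= <- _]; have /eqP/(congr1 (fun g => ghom_fun g y)) := zP. Qed.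

Lemma Ext_comp_neg p j (x : Ext R) : p < 0 -> Ext_comp (p, j) x -> x = 0.
Proof.
move=> p0 [f f_deg fx]; apply: (represents_coboundary (w := 0) fx).
rewrite linear0; apply: ghom_ext => y.
apply: (homog_eq (g := bP) (f := f) (h := \0)) => -[n i] v hv /=.
have [[n0 _]|ne] := eqVneq (n, i) (p, j); last exact: triv_bihomog_eq0 f_deg hv ne.
by rewrite (res_nonneg R hv) ?linear0 // n0.
Qed.

Lemma Ext_comp_generators (Q : lmodType A) (bQ : bigraded_module gA Q)
    (S : free_resolution bQ) (p : nat) (E : seq nat) (j : int) (x : Ext R) :
  generated_in_degrees bQ p E -> (forall e, e \in E -> j != e%:Z) ->
  Ext_comp (p%:Z, j) x -> x = 0.
Proof.
move=> gen jE [f f_deg fx].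
have [phi [phi_deg phi_aug phi_d]] := comparison_map R S p.
have [psi [psi_deg psi_aug psi_d]] := comparison_map S R p.
pose u : {linear P -> P} := psi \o phi \- idfun.
have [|y|m i y mp hy|h [h_deg hE]] := @nullhomotopy _ _ _ _ _ R u p.
- move=> m i y hy; have := psi_deg _ _ _ (phi_deg _ _ _ hy).
  by rewrite /= !subr0 => hyy; rewrite /homog raddfB hyy hy.
- by rewrite linearB /= psi_aug phi_aug subrr.
- have := phi_deg _ _ _ hy; rewrite /= !subr0 => hpy.
  by rewrite linearB /= (psi_d _ _ _ mp hpy) (phi_d _ _ _ mp hy).
(* [psi] preserves bidegrees, so generators of [Q_p] go to degrees other than [j], where [f]
   vanishes. *)
have f_psi y i : homog bQ (p%:Z, i) y -> f (psi y) = 0.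
  move/gen=> [T [a [z [hz ->]]]]; rewrite !linear_sum big1 // => t _.
  have [e eE hze] := hz t; rewrite !linearZ /=.
  have := psi_deg _ _ _ hze; rewrite /= !subr0 => hpz.
  rewrite (triv_bihomog_eq0 f_deg hpz) ?scaler0 //.
  by apply: contra (jE e eE) => /eqP[->].
(* On [P_p], applying [f] to [psi phi - 1 = d h + h d], with [f psi = 0] and [f d = 0], gives
   [f = - f h d]; hence the sign. *)
pose w := - ghom_comp f (GHom (bihomog_ghom_pred h_deg)).
apply: (represents_coboundary (w := w) fx); apply: ghom_ext => y.
apply: (homog_eq (g := bP) (f := f) (h := Hom_d R w)) => -[n i] v hv /=.
rewrite /scale_alg !scaleN1r.
have := h_deg _ _ _ (res_d_homog R hv); rewrite /= opprK subrK subr0 => hhv.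
have [[np ij]|ne] := eqVneq (n, i) (p%:Z, j); last first.
  by rewrite !(triv_bihomog_eq0 f_deg _ ne) ?oppr0.
have := phi_deg _ _ _ hv; rewrite /= !subr0 np => hpv.
have := congr1 f (hE n i v _ hv); rewrite np lexx => /(_ isT).
rewrite linearB linearD /= (f_psi _ _ hpv) (represents_cocycle _ fx) sub0r add0r.
by move=> <-; rewrite opprK.
Qed.

Lemma ghom_sumE (T : Type) (r : seq T) (Pr : pred T)
    (g : T -> ghom bP (triv_bigraded gA)) y :
  (\sum_(t <- r | Pr t) g t : ghom _ _) y = \sum_(t <- r | Pr t) g t y.
Proof.
exact: (big_morph (fun f : ghom bP (triv_bigraded gA) => f y)
  (id1 := 0) (op1 := +%R)).
Qed.

(** A representing cocycle is a finite sum of bihomogeneous maps, which need not be cocycles one by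
    one; grouping them by bidegree yields cocycles. *)
Lemma Ext_decomposition (x : Ext R) :
  exists (s : seq (int * int)) (w : int * int -> Ext R),
    (forall k, Ext_comp k (w k)) /\ x = \sum_(k <- s) w k.
Proof.
rewrite -[x]cohom_reprK; case: (cohom_repr x) => f fP.
have [T [k [g [g_deg fE]]]] := ghomP f.
pose gam t : ghom bP (triv_bigraded gA) := GHom (bihomog_ghom_pred (g_deg t)).
pose G c : ghom bP (triv_bigraded gA) := \sum_(t | k t == c) gam t.
have G_deg c : bihomog_map bP (triv_bigraded gA) c (G c).
  move=> n i y hy; rewrite ghom_sumE; apply: big_ind => [||t /eqP <-].
  - exact: homog0.
  - by move=> u v; apply: homogD.
  - exact: g_deg hy.
pose s := undup (codom k).
have Ef : f = \sum_(c <- s) G c.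
  apply: ghom_ext => y; rewrite fE ghom_sumE.
  under [RHS]eq_bigr => c _ do rewrite ghom_sumE.
  rewrite (exchange_big_dep xpredT) //=; apply: eq_bigr => t _.
  have kt : k t \in s by rewrite mem_undup codom_f.
  rewrite -big_filter; have -> : [seq c <- s | k t == c] = [:: k t].
    under eq_filter => c do rewrite eq_sym.
    by rewrite filter_pred1_uniq ?undup_uniq.
  by rewrite big_seq1.
have Gk c : c \notin s -> G c = 0.
  move=> cs; rewrite /G big_pred0 // => t.
  by apply: contraNF cs => /eqP <-; rewrite mem_undup codom_f.
have G_cocycle c : G c \in cocycle_pred (Hom_d R).
  apply/eqP/ghom_ext => y.
  apply: (homog_eq (g := bP) (f := Hom_d R (G c)) (h := \0)) => -[n i] v hv /=.
  have hdv := res_d_homog R hv.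
  have [Ec|ne] := eqVneq (n - 1, i) c; last exact: triv_bihomog_eq0 (G_deg c) hdv ne.
  have [cs|/Gk -> //] := boolP (c \in s).
  (* [res_d R v] has bidegree [c], so every other summand of [f] kills it and [G c] takes the value
     of [f] there, which is 0. *)
  have <- : f (res_d R v) = 0.
    by have /eqP/(congr1 (fun h => ghom_fun h v)) := fP.
  rewrite Ef ghom_sumE (bigD1_seq c) ?undup_uniq //= big1 ?addr0 // => c' c'c.
  by apply: triv_bihomog_eq0 (G_deg c') hdv _; rewrite Ec eq_sym.
exists s, (fun c => cohom_class (Cocycle (G_cocycle c))); split.
  by move=> c; exists (G c) => //; exists (Cocycle (G_cocycle c)).
rewrite -raddf_sum; congr (cohom_class _); apply: val_inj.
by rewrite raddf_sum.
Qed.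

End ExtComponents.

(** * Arithmetic of the degrees in [Delta] *)

Section Degrees.
Local Open Scope ring_scope.

(* The possible sums of n bidegrees of E(A): a, b and c of the cohomological
   degrees are 0, 1 and 2 modulo 3, c' of the last ones are paired with the
   larger lower degree, and K is the sum of the quotients by 3. *)
Definition Delta_degrees (d n : nat) (k : int * int) : Prop :=
  exists K a b c c' : nat, [/\ (c' <= c)%N, n = (a + b + c)%N,
    k.1 = (3 * K + b + 2 * c)%N%:Z & k.2 = (2 * d * K + b + d * c + c')%N%:Z].

Lemma Delta_degrees1 d p j : j \in [:: (Delta d p).1; (Delta d p).2] ->
  Delta_degrees d 1 (p%:Z, j%:Z).
Proof.
rewrite /Delta; move: (ltn_pmod p (isT : (0 < 3)%N)) (divn_eq p 3).
move: (p %% 3)%N (p %/ 3)%N => r q.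
rewrite !inE; case: r => [|[|[|]]] //= _ -> /orP[] /eqP -> /=.
- by exists q, 1, 0, 0, 0; split=> /=; lia.
- by exists q, 1, 0, 0, 0; split=> /=; lia.
- by exists q, 0, 1, 0, 0; split=> /=; lia.
- by exists q, 0, 1, 0, 0; split=> /=; lia.
- by exists q, 0, 0, 1, 0; split=> /=; lia.
- by exists q, 0, 0, 1, 1; split=> /=; lia.
Qed.

Lemma Delta_degreesD d n n' k k' : Delta_degrees d n k ->
  Delta_degrees d n' k' -> Delta_degrees d (n + n') (k + k').
Proof.
case: k k' => p j [p' j'] [K [a [b [c [e [ec En /= Ep Ej]]]]]].
move=> [K' [a' [b' [c' [e' [ec' En' /= Ep' Ej']]]]]].
exists (K + K')%N, (a + a')%N, (b + b')%N, (c + c')%N, (e + e')%N.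
by split=> /=; lia.
Qed.

(** The cohomological degrees give [3v + 4 = 2a + c + 2b' + 4c'], and the lower degrees determine
    [b + e]. For [v = 1] the arity is 2, 3 or 4, for [v = -1] it is [d] or [d + 1], and for [v = 0]
    both ranges occur. *)
Lemma Delta_arity (d n : nat) (k : int * int) : (2 <= d)%N ->
  Delta_degrees d n k -> Delta_degrees d 1 (k.1 + 2 - n%:Z, k.2) ->
  n \in [:: 2; 3; 4; d; d.+1].
Proof.
move=> d2 [K [a [b [c [e [ec En /= Ep Ej]]]]]].
move=> [K' [a' [b' [c' [e' [ec' En' /= Ep' Ej']]]]]].
(* -v is the coefficient of d once the two lower degrees are compared. *)
pose v : int := 2 * K%:Z + c%:Z - 2 * K'%:Z.
have Ev : b%:Z + e%:Z = b'%:Z + d%:Z * c'%:Z + e'%:Z - d%:Z * v.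
  by rewrite /v; nia.
(* Since [a' + b' + c' = 1], the sum [b' + d c' + e'] is at most [d + 1 < 2d]; thus [v >= 2] would
   make [b + e] negative. *)
have v_le1 : v <= 1.
  have [//|v1] := leP v 1; have : d%:Z * 2 <= d%:Z * v by nia.
  by case: c' ec' En' Ep' Ej' Ev => [|[|c']]; lia.
have v_ge : -1 <= v by lia.
have Ec' : c' = 0%N \/ c' = 1%N by lia.
have : v = -1 \/ v = 0 \/ v = 1 by lia.
have vE : v = 2 * K%:Z + c%:Z - 2 * K'%:Z by [].
move: v vE Ev {v_le1 v_ge Ej Ej'} => v vE Ev.
case=> [|[|]] v_val; rewrite v_val in vE Ev; case: Ec' => Ec; rewrite Ec in Ev.
all: rewrite !inE; lia.
Qed.

End Degrees.

(** * Vanishing of the products, first on homogeneous arguments, then on all *)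

Section Vanishing.
Local Open Scope ring_scope.
Variables (F : fieldType) (A : algType F) (gA : graded_algebra A).
Variables (d : nat) (hd : (2 <= d)%N) (hA : bi_Koszul gA d).
Variables (P : lmodType A) (bP : bigraded_module gA P) (R : free_resolution bP).

Lemma bi_Koszul_Ext_comp k (x : Ext R) :
  Ext_comp k x -> x != 0 -> Delta_degrees d 1 k.
Proof.
have [Q [bQ [S [_ gen]]]] := hA.
case: k => -[p|p] j hx x0; last first.
  by rewrite (Ext_comp_neg _ hx) ?eqxx in x0.
have [/hasP[e eE /eqP ->]|/hasPn je] :=
  boolP (has (fun e : nat => j == e%:Z) [:: (Delta d p).1; (Delta d p).2]).
  exact: Delta_degrees1.
by rewrite (Ext_comp_generators S (gen p) je hx) eqxx in x0.
Qed.

(** Zero entries are excluded because 0 lies in every component and does not constrain its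
    bidegree. *)
Lemma sum_Delta_degrees ks (xs : seq (Ext R)) :
  List.Forall2 (@Ext_comp _ _ _ _ _ R) ks xs -> 0 \notin xs ->
  Delta_degrees d (size xs) (\sum_(k <- ks) k.1, \sum_(k <- ks) k.2).
Proof.
elim=> [_|k x ks' xs' hx _ IH].
  by rewrite !big_nil; exists 0, 0, 0, 0, 0; split=> //=; lia.
rewrite inE negb_or eq_sym !big_cons => /andP[x0 /IH].
exact: Delta_degreesD (bi_Koszul_Ext_comp hx x0).
Qed.

Variables (m : seq (Ext R) -> Ext R) (hm : Ainf_Ext_structure m).

Lemma multilinear_eq0 (xs : seq (Ext R)) : 0 \in xs -> m xs = 0.
Proof.
case/splitPr=> s1 s2; have := Ainf_multilinear (Ext_Ainf hm) s1 s2 (-1) 0 0.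
by rewrite scaler0 addr0 scaleN1r addNr.
Qed.

Lemma higher_product_homog_eq0 ks (xs : seq (Ext R)) :
  List.Forall2 (@Ext_comp _ _ _ _ _ R) ks xs -> (0 < size xs)%N ->
  size xs \notin [:: 2; 3; 4; d; d.+1] -> m xs = 0.
Proof.
move=> hxs xs0; apply: contraNeq => mxs.
have xsn0 : 0 \notin xs by apply: contraNN mxs => /multilinear_eq0 ->.
apply: (Delta_arity hd (sum_Delta_degrees hxs xsn0)).
exact: bi_Koszul_Ext_comp (Ext_lower hm hxs xs0) mxs.
Qed.

(** The prefix [xs] is already homogeneous; the induction decomposes the head of [ys] and moves each
    component to the end of [xs], keeping the arity. *)
Lemma higher_product_eq0 (xs ys : seq (Ext R)) ks :
  List.Forall2 (@Ext_comp _ _ _ _ _ R) ks xs -> (0 < size (xs ++ ys))%N ->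
  size (xs ++ ys) \notin [:: 2; 3; 4; d; d.+1] -> m (xs ++ ys) = 0.
Proof.
elim: ys xs ks => [|y ys IH] xs ks hxs.
  by rewrite cats0; apply: higher_product_homog_eq0 hxs.
move=> n0 nd; have [s [w [hw ->]]] := Ext_decomposition y.
have m_lin := Ainf_multilinear (Ext_Ainf hm) xs ys.
elim: s => [|k s IHs].
  by rewrite big_nil multilinear_eq0 // mem_cat inE eqxx orbT.
rewrite big_cons -[w k]scale1r m_lin IHs addr0 scale1r -cat_rcons.
rewrite -cat_rcons size_cat size_rcons -(size_rcons xs (w k)) -size_cat in n0 nd.
apply: (IH _ (rcons ks k)) => //.
by rewrite -!cats1; apply: List.Forall2_app => //; constructor.
Qed.

End Vanishing.

Theorem theorem2p3 (F : fieldType) (A : algType F) (gA : graded_algebra A)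
    (d : nat) (hd : (2 <= d)%N) (hA : bi_Koszul gA d)
    (P : lmodType A) (bP : bigraded_module gA P) (R : free_resolution bP)
    (m : seq (Ext R) -> Ext R) (hm : Ainf_Ext_structure m) :
  forall n : nat, (0 < n)%N -> n \notin [:: 2; 3; 4; d; d.+1] ->
  forall xs : seq (Ext R), size xs = n -> m xs = 0%R.
Proof.
move=> n n0 nd xs xsn; rewrite -xsn in n0 nd.
exact: (higher_product_eq0 hd hA hm (xs := [::]) (List.Forall2_nil _) n0 nd).
Qed.
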